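(* Let $f$ be a TFPL. Then $f$ is stable (i.e. $\mathrm{WL}(f)=f$) if and only if $f$ contains no drifter.
   Context: The graph $G^N$ ($N\ge1$): the induced subgraph of the square grid made up of $N$ consecutive centered rows of $3,5,\dots,2N+1$ vertices from top to bottom, together with $2N+1$ vertical external edges hanging down from the $2N+1$ vertices of the bottom row (their lower endpoints are not counted as vertices). $\mathcal{L}^N=\{L_1,\dots,L_N\}$ (resp. $\mathcal{R}^N=\{R_1,\dots,R_N\}$) is the set of leftmost (resp. rightmost) vertices of the rows, numbered from left to right; so $L_1$ and $R_N$ lie in the bottom row, $L_N$ and $R_1$ in the top row. The cells of $G^N$ are its $N(N+1)$ unit squares, including the $2N$ external squares below the bottom row, each of which has only three surrounding edges (top, left, right). Cells are partitioned chessboard-wise into odd and even cells, the top left cell being odd. A TFPL (triangular fully packed loop configuration) of size $N$ is a subgraph $f$ of $G^N$ such that: (i) exactly every other external edge, starting with the second from the left, belongs to $f$; (ii) the vertices in $\mathcal{L}^N\cup\mathcal{R}^N$ have degree 0 or 1; (iii) all other vertices of $G^N$ have degree 2; (iv) no path in $f$ connects two vertices of $\mathcal{L}^N$ or two vertices of $\mathcal{R}^N$. Wieland gyration of a cell: if the cell contains precisely two edges of the configuration and these lie on opposite sides, it is unchanged; otherwise edges and non-edges among its surrounding edges are exchanged. Left-Wieland gyration $\mathrm{WL}(f)$ of a TFPL $f$: (1) insert a vertex $L_i'$ to the left of $L_i$ for all $i$, and add a horizontal edge between $L'_i$ and $L_i$ for every $i$ such that $L_i$ has degree 1 in $f$;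 (2) apply Wieland gyration to each odd cell of $f$; (3) delete all vertices in $\mathcal{R}^N$ and their incident edges; finally shift everything one unit to the right. The result is a TFPL of size $N$. Vertices of $G^N$ are partitioned chessboard-wise into odd and even vertices, the vertices in $\mathcal{L}^N$ being odd. A drifter is a vertical edge of a TFPL joining two vertices of $G^N$ whose top vertex is odd and whose bottom vertex is even. *)

(* Defs.v *)
From HB Require Import structures.
From mathcomp Require Import all_boot all_order all_algebra.
From mathcomp Require Import zify.
Set Implicit Arguments.
Unset Strict Implicit.
Unset Printing Implicit Defensive.
Import Order.TTheory GRing.Theory Num.Theory.
Local Open Scope ring_scope.

(* A point is (row, column); rows are numbered downwards, and row i of G^N,
   1 <= i <= N, is centered on column 0. *)
Definition point : Type := (int * int)%type.

Definition right_of (p : point) : point := (p.1, p.2 + 1).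
Definition left_of (p : point) : point := (p.1, p.2 - 1).
Definition below (p : point) : point := (p.1 + 1, p.2).
Definition above (p : point) : point := (p.1 - 1, p.2).

(* Edges of the square grid Z^2: [Hor p] joins p to its right neighbour, and
   [Ver p] joins p to the neighbour below it. *)
Inductive edge := Hor of point | Ver of point.

Definition edge_code (e : edge) : point + point :=
  match e with Hor p => inl p | Ver p => inr p end.
Definition edge_decode (s : point + point) : edge :=
  match s with inl p => Hor p | inr p => Ver p end.
Lemma edge_codeK : cancel edge_code edge_decode.
Proof. by case. Qed.
HB.instance Definition _ := Equality.copy edge (can_type edge_codeK).

Definition endpoints (e : edge) : seq point :=
  match e with Hor p => [:: p; right_of p] | Ver p => [:: p; below p] end.

(* A subgraph is given by its edge set. *)
Definition config := pred edge.

Definition vertex (N : nat) (p : point) : bool :=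
  (1 <= p.1 <= N%:Z) && (- p.1 <= p.2 <= p.1).

Definition external (N : nat) (e : edge) : bool :=
  if e is Ver p then vertex N p && (p.1 == N%:Z) else false.

Definition graph_edge (N : nat) (e : edge) : bool :=
  all (vertex N) (endpoints e) || external N e.

Definition leftmost (N : nat) (p : point) : bool :=
  vertex N p && (p.2 == - p.1).
Definition rightmost (N : nat) (p : point) : bool :=
  vertex N p && (p.2 == p.1).

Definition incident_edges (p : point) : seq edge :=
  [:: Hor p; Hor (left_of p); Ver p; Ver (above p)].

Definition degree (f : config) (p : point) : nat := count f (incident_edges p).

Definition adjacent (f : config) : rel point := fun p q =>
  has (fun e => f e && (q \in endpoints e) && (q != p)) (incident_edges p).

Definition path_between (f : config) (p q : point) : Prop :=
  exists s : seq point, [/\ path (adjacent f) p s, uniq (p :: s) & last p s = q].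

(* Chessboard parity; all points (i, - i), hence all leftmost vertices, are
   odd.  A unit square is identified with its upper left corner, so the same
   predicate gives the parity of cells, the top left cell (1, -1) being odd. *)
Definition odd_point (p : point) : bool := (2 %| p.1 + p.2)%Z.

(* The columns of the external edges run from - N to N; the second, fourth, ...
   ones are those for which j + N is odd. *)
Record tfpl (N : nat) (f : config) : Prop := Tfpl {
  tfpl_sub : forall e, f e -> graph_edge N e;
  tfpl_ext : forall p, external N (Ver p) ->
    f (Ver p) = ~~ (2 %| p.2 + N%:Z)%Z;
  tfpl_boundary : forall p, leftmost N p || rightmost N p ->
    (degree f p <= 1)%N;
  tfpl_interior : forall p, vertex N p -> ~~ leftmost N p ->
    ~~ rightmost N p -> degree f p = 2;
  tfpl_left : forall p q, leftmost N p -> leftmost N q -> p <> q ->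
    ~ path_between f p q;
  tfpl_right : forall p q, rightmost N p -> rightmost N q -> p <> q ->
    ~ path_between f p q
}.

Definition cell (N : nat) (c : point) : bool :=
  (1 <= c.1 <= N%:Z) && (- c.1 <= c.2 < c.1).

Definition top_side (c : point) : edge := Hor c.
Definition bottom_side (c : point) : edge := Hor (below c).
Definition left_side (c : point) : edge := Ver c.
Definition right_side (c : point) : edge := Ver (right_of c).

(* The filter drops the missing bottom side of the external cells. *)
Definition sides (N : nat) (c : point) : seq edge :=
  [seq e <- [:: top_side c; bottom_side c; left_side c; right_side c]
   | graph_edge N e].

Definition opposite_pair (N : nat) (f : config) (c : point) : bool :=
  [seq e <- sides N c | f e]
    \in [:: [:: top_side c; bottom_side c]; [:: left_side c; right_side c]].

Definition gyration (N : nat) (c : point) (f : config) : config := fun e =>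
  if ~~ opposite_pair N f c && (e \in sides N c) then ~~ f e else f e.

(* Every edge of the grid is a side of exactly one odd square. *)
Definition odd_square (e : edge) : point :=
  match e with
  | Hor p => if odd_point p then p else above p
  | Ver p => if odd_point p then p else left_of p
  end.

Lemma odd_squareP (N : nat) (c : point) (e : edge) :
  odd_point c -> e \in sides N c -> c = odd_square e.
Proof.
rewrite mem_filter !inE => Hc /andP[_].
case: c Hc => i j; rewrite /odd_point /= => Hc.
by case/or4P => /eqP-> /=; rewrite /odd_point /above /left_of /=;
  case: ifP => H; rewrite ?addrK //; exfalso; lia.
Qed.

Lemma odd_square_odd (e : edge) : odd_point (odd_square e).
Proof. by case: e => -[i j]; rewrite /odd_square; case: ifP => //; rewrite /odd_point /=; lia. Qed.

(* By [odd_squareP] distinct odd cells have no common side, so their gyrations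
   can be applied in any order, or simultaneously as here. *)
Definition gyrate_odd (N : nat) (f : config) : config := fun e =>
  if cell N (odd_square e) then gyration N (odd_square e) f e else f e.

(* The edge [Hor p] added here joins p = L'_i to L_i, its right neighbour. *)
Definition insert_left (N : nat) (f : config) : config := fun e =>
  f e || (if e is Hor p
          then leftmost N (right_of p) && (degree f (right_of p) == 1)
          else false).

Definition delete_right (N : nat) (f : config) : config := fun e =>
  f e && ~~ has (rightmost N) (endpoints e).

Definition shift_right (f : config) : config := fun e =>
  match e with
  | Hor p => f (Hor (left_of p))
  | Ver p => f (Ver (left_of p))
  end.

Definition WL (N : nat) (f : config) : config :=
  shift_right (delete_right N (gyrate_odd N (insert_left N f))).

Definition stable (N : nat) (f : config) : Prop := WL N f =1 f.

Definition drifter (N : nat) (f : config) (e : edge) : bool :=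
  if e is Ver p then
    [&& f e, vertex N p, vertex N (below p), odd_point p
      & ~~ odd_point (below p)]
  else false.

(* Main.v *)
Require Import Defs.
From mathcomp Require Import all_boot.
From mathcomp Require Import all_order all_algebra zify.
Set Implicit Arguments.
Unset Strict Implicit.
Unset Printing Implicit Defensive.
Import Order.TTheory GRing.Theory Num.Theory.

(* Left-Wieland gyration sends the four sides of an odd cell to those of the
   even cell to its right, and the left sides of the odd cells are the only
   possible places for drifters.  If none of them is occupied, the degree
   condition at the two right corners of an odd cell forces either its right
   side to be occupied, or exactly its top and bottom to be; in both cases the
   image of the cell agrees with [f].  Conversely, if a stable [f] had
   drifters, look at the leftmost one in the highest row containing some: the
   odd cell having it beyond its right side has empty left and right sides, so
   its top side is exchanged with the edge following it, and the degree
   condition at the even vertex between them yields a drifter one row higher. *)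

Section Gyration.

Local Open Scope ring_scope.

Lemma right_ofK : cancel right_of left_of.
Proof. by case=> i j; rewrite /left_of /= addrK. Qed.

Lemma left_ofK : cancel left_of right_of.
Proof. by case=> i j; rewrite /right_of /= subrK. Qed.

Lemma belowK : cancel below above.
Proof. by case=> i j; rewrite /above /= addrK. Qed.

Lemma aboveK : cancel above below.
Proof. by case=> i j; rewrite /below /= subrK. Qed.

(** * Gyration of a single odd cell *)

Variables (N : nat) (f : config).
Hypothesis hf : tfpl N f.

Lemma insert_left_graph_edge e : graph_edge N e -> insert_left N f e = f e.
Proof.
case: e => -[i j]; rewrite /insert_left ?orbF // => He.
suff /negbTE-> : ~~ leftmost N (right_of (i, j)) by rewrite orbF.
by move: He; rewrite /graph_edge /leftmost /vertex /=; lia.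
Qed.

Lemma f_off e : ~~ graph_edge N e -> f e = false.
Proof. by move=> /negP He; apply/negP => /(tfpl_sub hf). Qed.

(** Inserted edges start outside $G^N$, so they are sides of no cell and do not affect which cells
    are opposite pairs. *)
Lemma gyrate_odd_cell e : cell N (odd_square e) -> graph_edge N e ->
  gyrate_odd N (insert_left N f) e =
    f e (+) ~~ opposite_pair N f (odd_square e).
Proof.
move=> Hc He; rewrite /gyrate_odd Hc /gyration.
have -> : opposite_pair N (insert_left N f) (odd_square e)
        = opposite_pair N f (odd_square e).
  rewrite /opposite_pair; congr (in_mem _ _); apply: eq_in_filter => e'.
  by rewrite mem_filter => /andP[/insert_left_graph_edge].
have -> : e \in sides N (odd_square e).
  rewrite mem_filter He /=; move: {Hc He} e => [] [i j]; rewrite /odd_square;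
    case: ifP => _; rewrite !inE /top_side /bottom_side /left_side /right_side;
    by rewrite ?aboveK ?left_ofK eqxx ?orbT.
by rewrite insert_left_graph_edge // andbT; case: opposite_pair; case: (f e).
Qed.

(** External cells are covered too: their missing bottom side is no graph edge, so [f] is false on
    it. *)
Lemma opposite_pair_sides c : cell N c -> opposite_pair N f c =
  [&& f (top_side c), f (bottom_side c), ~~ f (left_side c)
    & ~~ f (right_side c)] ||
  [&& ~~ f (top_side c), ~~ f (bottom_side c), f (left_side c)
    & f (right_side c)].
Proof.
case: c => i j Hc; rewrite /opposite_pair /sides -filter_predI.
rewrite (@eq_filter _ _ f); last first.
  by move=> e /=; case: (boolP (graph_edge N e)) => [_|/f_off->];
    rewrite ?andbT.
rewrite /= /top_side /bottom_side /left_side /right_side.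
have E1 : (i + 1 == i) = false by lia.
have E2 : (j + 1 == j) = false by lia.
have E3 : (i == i + 1) = false by lia.
have E4 : (j == j + 1) = false by lia.
have hh p q : (Hor p == Hor q) = (p == q) by [].
have vv p q : (Ver p == Ver q) = (p == q) by [].
have hv p q : (Hor p == Ver q) = false by [].
have vh p q : (Ver p == Hor q) = false by [].
by do 4!case: (f _); rewrite !inE ?eqseq_cons ?hh ?vv ?hv ?vh /below /right_of
  ?xpair_eqE ?E1 ?E2 ?E3 ?E4 ?eqxx ?andbF.
Qed.

(** * Images of the four sides of an odd cell *)

Lemma WL_top c : odd_point c -> cell N c ->
  WL N f (Hor (right_of c)) = f (Hor c) (+) ~~ opposite_pair N f c.
Proof.
move=> oc cc; have Ec : odd_square (Hor c) = c by rewrite /odd_square oc.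
rewrite /WL /shift_right right_ofK /delete_right gyrate_odd_cell ?Ec //.
  (* By parity [c.2 <= c.1 - 2], so the edge has no rightmost endpoint and survives the deletion. *)
  rewrite (_ : has _ _ = false) ?andbT //.
  by case: c {Ec} oc cc => i j; rewrite /odd_point /cell /rightmost /=; lia.
by case: c {Ec} oc cc => i j;
  rewrite /odd_point /cell /graph_edge /external /vertex /=; lia.
Qed.

Lemma WL_bottom c : odd_point c -> cell N c -> c.1 < N%:Z ->
  WL N f (Hor (right_of (below c)))
  = f (Hor (below c)) (+) ~~ opposite_pair N f c.
Proof.
move=> oc cc lc; have Ec : odd_square (Hor (below c)) = c.
  rewrite /odd_square belowK; case: ifP => //.
  by case: c oc {cc lc} => i j; rewrite /odd_point /=; lia.
rewrite /WL /shift_right right_ofK /delete_right gyrate_odd_cell ?Ec //.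
  rewrite (_ : has _ _ = false) ?andbT //.
  by case: c {Ec} oc cc lc => i j; rewrite /odd_point /cell /rightmost /=; lia.
by case: c {Ec} oc cc lc => i j;
  rewrite /odd_point /cell /graph_edge /external /vertex /=; lia.
Qed.

Lemma WL_left c : odd_point c -> cell N c ->
  WL N f (Ver (right_of c)) = f (Ver c) (+) ~~ opposite_pair N f c.
Proof.
move=> oc cc; have Ec : odd_square (Ver c) = c by rewrite /odd_square oc.
rewrite /WL /shift_right right_ofK /delete_right gyrate_odd_cell ?Ec //.
  rewrite (_ : has _ _ = false) ?andbT //.
  by case: c {Ec} oc cc => i j; rewrite /odd_point /cell /rightmost /=; lia.
by case: c {Ec} oc cc => i j;
  rewrite /odd_point /cell /graph_edge /external /vertex /=; lia.
Qed.

Lemma WL_right c : odd_point c -> cell N c ->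
  WL N f (Ver (right_of (right_of c)))
  = f (Ver (right_of c)) (+) ~~ opposite_pair N f c.
Proof.
move=> oc cc; have Ec : odd_square (Ver (right_of c)) = c.
  rewrite /odd_square right_ofK; case: ifP => //.
  by case: c oc {cc} => i j; rewrite /odd_point /=; lia.
rewrite /WL /shift_right right_ofK /delete_right gyrate_odd_cell ?Ec //.
  rewrite (_ : has _ _ = false) ?andbT //.
  by case: c {Ec} oc cc => i j; rewrite /odd_point /cell /rightmost /=; lia.
by case: c {Ec} oc cc => i j;
  rewrite /odd_point /cell /graph_edge /external /vertex /=; lia.
Qed.

Lemma interior_degree q : vertex N q -> - q.1 < q.2 < q.1 ->
  (f (Hor q) + f (Hor (left_of q)) + f (Ver q) + f (Ver (above q)))%N = 2%N.
Proof.
move=> vq iq; have := tfpl_interior hf vq; rewrite /degree /= addn0 !addnA.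
by apply; case: q vq iq => i j; rewrite /leftmost /rightmost /=; lia.
Qed.

Lemma gyrate_odd_off e :
  ~~ (cell N (odd_square e) && graph_edge N e) ->
  gyrate_odd N (insert_left N f) e = insert_left N f e.
Proof.
rewrite /gyrate_odd; case: ifP => //= _ /negbTE He.
by rewrite /gyration mem_filter He andbF.
Qed.

(** * Stability excludes vertical edges below odd points *)

Lemma stable_no_odd_vertical : stable N f ->
  forall p, odd_point p -> f (Ver p) = false.
Proof.
move=> st.
(* The odd points of row [n] are enumerated from its left end [m = 0]; a double induction replaces
   the choice of a first drifter. *)
suff H (n m : nat) : f (Ver (n%:Z, m%:Z *+ 2 - n%:Z)) = false.
  case=> i j oij; case: (boolP (graph_edge N (Ver (i, j)))) => [gij|/f_off//].
  have [ni nj] : (0 <= i) /\ (0 <= i + j).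
    by move: gij; rewrite /graph_edge /external /vertex /=; lia.
  rewrite -(H `|i|%N `|((i + j) %/ 2)%Z|%N); congr (f (Ver _)).
  by congr pair; move: oij; rewrite /odd_point /=; lia.
elim: n m => [|n IHn] m.
  by apply: f_off; rewrite /graph_edge /external /vertex /=; lia.
elim: m => [|m IHm].
  (* By stability this edge comes from the one to its left, which lies outside the graph and in no
     odd cell; only horizontal edges are inserted. *)
  rewrite -st /WL /shift_right /delete_right /gyrate_odd.
  set c := left_of _.
  have -> : cell N (odd_square (Ver c)) = false.
    by rewrite /odd_square /c /cell /odd_point /left_of /=;
      case: ifP => //=; lia.
  rewrite /insert_left orbF f_off //.
  by rewrite /c /left_of /graph_edge /external /vertex /=; lia.
set c : point := (n.+1%:Z, m%:Z *+ 2 - n.+1%:Z) in IHm.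
have -> : (n.+1%:Z, m.+1%:Z *+ 2 - n.+1%:Z) = right_of (right_of c).
  by rewrite /right_of /c /=; congr pair; lia.
have oc : odd_point c by rewrite /odd_point /c /=; lia.
case: (boolP (cell N c)) => [cc|nc]; last first.
  apply: f_off; move: nc; rewrite /cell /graph_edge /external /vertex /=; lia.
have Hr := WL_right oc cc; have Ht := WL_top oc cc.
have : f (Ver (above (right_of c))) = false.
  rewrite -(IHn m); congr (f (Ver _)); rewrite /above /right_of /c /=.
  by congr pair; lia.
have vq : vertex N (right_of c) by move: cc; rewrite /cell /vertex /=; lia.
have iq : - (right_of c).1 < (right_of c).2 < (right_of c).1.
  by move: oc cc; rewrite /odd_point /cell /=; lia.
have := interior_degree vq iq.
move: Hr Ht; rewrite right_ofK !st (opposite_pair_sides cc) /top_side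
  /left_side /right_side IHm.
(* The left side is empty. If the right side is occupied, the cell is toggled and the edge in
   question is empty. If not, an occupied edge would mean a toggled cell, hence just one horizontal
   edge at [right_of c], whose degree would be 1. *)
case: (f (Hor c)); case: (f (bottom_side c)); case: (f (Ver (right_of c)));
  case: (f (Hor (right_of c))); case: (f (Ver (above (right_of c))));
  by case: (f (Ver (right_of (right_of c)))).
Qed.

(** * Absence of vertical edges below odd points implies stability *)

Section NoDrifter.

Hypothesis nd : forall p, odd_point p -> f (Ver p) = false.

Lemma top_right_degree c : odd_point c -> cell N c ->
  (f (Hor (right_of c)) + f (Hor c) + f (Ver (right_of c)))%N = 2%N.
Proof.
move=> oc cc; have := @interior_degree (right_of c).
rewrite right_ofK (nd (p := above _)) ?addn0; last first.
  by move: oc; rewrite /odd_point /=; lia.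
by apply; move: oc cc; rewrite /odd_point /cell /vertex /=; lia.
Qed.

(** This corner is odd, so [nd] removes the edge below it; at the even top right corner it removes
    the edge above. *)
Lemma bottom_right_degree c : odd_point c -> cell N c -> c.1 < N%:Z ->
  (f (Hor (right_of (below c))) + f (Hor (below c)) + f (Ver (right_of c)))%N
  = 2%N.
Proof.
move=> oc cc lc; have := @interior_degree (right_of (below c)).
rewrite right_ofK (nd (p := right_of _)) ?addn0; last first.
  by move: oc; rewrite /odd_point /=; lia.
have -> : above (right_of (below c)) = right_of c.
  by rewrite /above /right_of /below /= addrK.
by apply; move: oc cc lc; rewrite /odd_point /cell /vertex /=; lia.
Qed.

(** The left side is empty, and an empty right side forces top and bottom to be occupied by the two
    corner degrees. *)
Lemma opposite_pair_right c : odd_point c -> cell N c ->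
  opposite_pair N f c = ~~ f (right_side c).
Proof.
move=> oc cc; have := top_right_degree oc cc.
rewrite opposite_pair_sides // (nd (p := c)) // /top_side /bottom_side
  /right_side.
case: (boolP (c.1 < N%:Z)) => [lc|gc].
  have := bottom_right_degree oc cc lc.
  by case: (f (Hor c)); case: (f (Hor (below c)));
    case: (f (Ver (right_of c))); case: (f (Hor (right_of c)));
    case: (f (Hor (right_of (below c)))).
(* In the last row the right side is external, and parity makes it one of those that belong to
   [f]. *)
rewrite (tfpl_ext hf (p := right_of c)); last first.
  by move: cc gc; rewrite /cell /external /vertex /=; lia.
suff -> : ~~ (2 %| (right_of c).2 + N%:Z)%Z by rewrite !andbF.
by move: oc cc gc; rewrite /odd_point /cell /=; lia.
Qed.

Lemma no_odd_vertical_stable_hor p : WL N f (Hor p) = f (Hor p).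
Proof.
rewrite -[p]left_ofK; set q := left_of p; case: (boolP (odd_point q)) => oq.
  case: (boolP (cell N q)) => [cq|nq].
    rewrite WL_top // opposite_pair_right // /right_side.
    have := top_right_degree oq cq.
    by case: (f (Hor q)); case: (f (Hor (right_of q)));
      case: (f (Ver (right_of q))).
  rewrite /WL /shift_right right_ofK /delete_right gyrate_odd_off; last first.
    by rewrite /odd_square oq (negbTE nq).
  rewrite (f_off (e := Hor (right_of q))); last first.
    move: oq nq.
    by rewrite /odd_point /cell /graph_edge /external /vertex /=; lia.
  rewrite /insert_left (f_off (e := Hor q)).
    rewrite (_ : leftmost _ _ = false) //.
    by move: oq; rewrite /odd_point /leftmost /=; lia.
  move: oq nq.
  by rewrite /odd_point /cell /graph_edge /external /vertex /=; lia.
have oc : odd_point (above q) by move: oq; rewrite /odd_point /=; lia.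
case: (boolP (cell N (above q) && ((above q).1 < N%:Z))) => [/andP[cc lc]|nc].
  rewrite -[q]aboveK WL_bottom // opposite_pair_right // /right_side.
  have := bottom_right_degree oc cc lc.
  by case: (f (Hor (below _))); case: (f (Hor (right_of _)));
    case: (f (Ver (right_of _))).
rewrite /WL /shift_right right_ofK /delete_right gyrate_odd_off; last first.
  rewrite /odd_square (negbTE oq).
  by move: nc; rewrite /cell /graph_edge /external /vertex /=; lia.
(* What remains is the boundary: edges deleted on the right, edges inserted on the left, and edges
   off the graph. *)
case: (boolP (rightmost N (right_of q))) => [rq|nr].
  rewrite [has _ _]/= rq orbT andbF f_off //.
  by move: rq; rewrite /rightmost /graph_edge /external /vertex /=; lia.
have nq : ~~ graph_edge N (Hor q).
  move: oq nr nc.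
  by rewrite /odd_point /rightmost /cell /graph_edge /external /vertex /=; lia.
rewrite /insert_left (f_off nq) /=.
case: (boolP (leftmost N (right_of q))) => [lq|nl] /=; last first.
  rewrite f_off //.
  move: oq nl nr nc; rewrite /odd_point /leftmost /rightmost /cell.
  by rewrite /graph_edge /external /vertex /=; lia.
rewrite (_ : rightmost N q = false); last first.
  by move: lq; rewrite /leftmost /rightmost /vertex /=; lia.
(* Only the right edge at this leftmost vertex can be present, so an edge is inserted exactly when
   that one is in [f], and the shift moves it there. *)
rewrite (negbTE nr) andbT /degree /= right_ofK (f_off nq).
rewrite nd; last by move: oq; rewrite /odd_point /=; lia.
rewrite (f_off (e := Ver _)).
  by case: (f _).
by move: lq; rewrite /leftmost /graph_edge /external /vertex /=; lia.
Qed.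

(** Toggling exactly when the right side is occupied moves the value of the right side to the empty
    left side and empties the right one; the shift then restores [f]. *)
Lemma no_odd_vertical_stable_ver p : WL N f (Ver p) = f (Ver p).
Proof.
rewrite -[p]left_ofK; set q := left_of p; case: (boolP (odd_point q)) => oq.
  case: (boolP (cell N q)) => [cq|nq].
    by rewrite WL_left // opposite_pair_right // nd // negbK.
  rewrite /WL /shift_right right_ofK /delete_right gyrate_odd_off; last first.
    by rewrite /odd_square oq (negbTE nq).
  rewrite /insert_left nd //= f_off //.
  move: oq nq.
  by rewrite /odd_point /cell /graph_edge /external /vertex /=; lia.
have oc : odd_point (left_of q) by move: oq; rewrite /odd_point /=; lia.
rewrite [RHS]nd; last by move: oq; rewrite /odd_point /=; lia.
case: (boolP (cell N (left_of q))) => [cc|nc].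
  rewrite -[q]left_ofK WL_right // opposite_pair_right // /right_side.
  by case: (f _).
rewrite /WL /shift_right right_ofK /delete_right gyrate_odd_off; last first.
  by rewrite /odd_square (negbTE oq) (negbTE nc).
rewrite /insert_left f_off //.
by move: oq nc; rewrite /odd_point /cell /graph_edge /external /vertex /=; lia.
Qed.

End NoDrifter.

(* An external edge below an odd vertex is not a drifter, but condition (i)
   excludes it from [f]. *)
Lemma no_drifterP : ~ (exists e, drifter N f e) <->
  forall p, odd_point p -> f (Ver p) = false.
Proof.
split=> [nd p op|nd [[//|p]] /and5P[+ _ _ op _]]; last by rewrite nd.
apply/negP => fp; have gp := tfpl_sub hf fp.
case: (boolP (external N (Ver p))) => [ep|ne].
  move: fp; rewrite (tfpl_ext hf ep).
  by move: op ep; rewrite /odd_point /external /vertex /=; lia.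
apply: nd; exists (Ver p); rewrite /drifter fp op /=.
by move: op gp; rewrite /graph_edge (negbTE ne) /odd_point /=; lia.
Qed.

End Gyration.

Theorem theorem4 (N : nat) (hN : 0 < N) (f : config) (hf : tfpl N f) :
  stable N f <-> ~ (exists e : edge, drifter N f e).
Proof.
rewrite (no_drifterP hf); split=> [st|nd].
  exact: (stable_no_odd_vertical hf st).
case=> p; first exact: (no_odd_vertical_stable_hor hf nd).
exact: (no_odd_vertical_stable_ver hf nd).
Qed.
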